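(* Let $A=[a_{ij}]$ be an $n\times n$ complex matrix with constant row sum $\gamma$, and let $I=\{1,\ldots,n\}$. For $i\in I$ and $k\in I\setminus\{i\}$ define the disc $$G_{A(i)}(k)=\Big\{z\in\mathbb{C}: |z-a_{kk}+a_{ik}|\le \sum_{j\in I\setminus\{i,k\}}|a_{kj}-a_{ij}|\Big\},$$ and let $G_{A(i)}=\bigcup_{k\in I\setminus\{i\}}G_{A(i)}(k)$. Then every eigenvalue of $A$ lies in $$\bigcap_{i=1}^n\Big[G_{A(i)}\cup\{\gamma\}\Big].$$
   Context: Constant row sum $\gamma$ means $\sum_{j=1}^n a_{ij}=\gamma$ for every $i$. *)

(* Defs.v *)
From mathcomp Require Import all_boot all_order all_algebra.
From mathcomp Require Import complex.
From mathcomp Require Import classical_sets reals.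

Set Implicit Arguments.
Unset Strict Implicit.
Unset Printing Implicit Defensive.

Import Order.TTheory GRing.Theory Num.Theory.

Local Open Scope classical_set_scope.
Local Open Scope ring_scope.
Local Open Scope complex_scope.

Definition constant_row_sum (R : realType) (n : nat) (A : 'M[R[i]]_n)
    (gamma : R[i]) : Prop :=
  forall p : 'I_n, \sum_(j < n) A p j = gamma.

(* `|_| is the complex modulus, and <= on R[i] compares the real values on
   both sides. *)
Definition gershgorin_disc (R : realType) (n : nat) (A : 'M[R[i]]_n)
    (p k : 'I_n) : set R[i] :=
  [set z | `|z - A k k + A p k|
             <= \sum_(j < n | (j != p) && (j != k)) `|A k j - A p j|].

Definition gershgorin_region (R : realType) (n : nat) (A : 'M[R[i]]_n)
    (p : 'I_n) : set R[i] :=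
  \bigcup_(k in [set k : 'I_n | k != p]) gershgorin_disc A p k.

(* Main.v *)
(* For an eigenvalue z <> gamma, a left eigenvector v has zero coordinate sum,
   so v restricted to the indices k <> p is a left eigenvector of
   [a_kj - a_pj].  Summing the moduli of its coordinate equations over j and
   exchanging the sums turns the column estimates into the row estimates of the
   discs, as in the l^1 proof of Gershgorin's theorem. *)
Require Import Defs.
From mathcomp Require Import all_boot all_order all_algebra.
From mathcomp Require Import complex.
From mathcomp Require Import classical_sets reals.

Set Implicit Arguments.
Unset Strict Implicit.
Unset Printing Implicit Defensive.

Import Order.TTheory GRing.Theory Num.Theory.

Local Open Scope classical_set_scope.
Local Open Scope ring_scope.
Local Open Scope complex_scope.

(** Multiplying [v *m A = z *: v] by the all-ones column gives [gamma * s = z * s] for the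
    coordinate sum [s] of [v]. *)
Lemma row_eigenvector_sum_eq0 (F : fieldType) (n : nat) (A : 'M[F]_n)
    (gamma z : F) (v : 'rV[F]_n) :
    (forall p, \sum_j A p j = gamma) -> v *m A = z *: v -> z != gamma ->
  \sum_k v 0 k = 0.
Proof.
move=> hA vA zNgamma; apply/eqP.
have : \sum_j (v *m A) 0 j = gamma * \sum_k v 0 k.
  under eq_bigr do rewrite mxE.
  rewrite exchange_big mulr_sumr; apply: eq_bigr => k _.
  by rewrite -mulr_sumr hA mulrC.
under eq_bigr do rewrite vA mxE.
rewrite -mulr_sumr => /eqP.
by rewrite -subr_eq0 -mulrBl mulf_eq0 subr_eq0 (negPf zNgamma).
Qed.

(** As [v] has zero sum, subtracting the constant [A p j] from column [j] leaves its product with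
    [v] unchanged, and it kills the term [k = p]. *)
Lemma row_eigenvector_deflation (F : fieldType) (n : nat) (A : 'M[F]_n) (z : F)
    (v : 'rV[F]_n) (p j : 'I_n) :
    \sum_k v 0 k = 0 -> v *m A = z *: v ->
  z * v 0 j = \sum_(k | k != p) v 0 k * (A k j - A p j).
Proof.
move=> v0 vA; have -> : z * v 0 j = \sum_k v 0 k * (A k j - A p j).
  under eq_bigr do rewrite mulrBr.
  rewrite sumrB -mulr_suml v0 mul0r subr0.
  by have /rowP/(_ j) := vA; rewrite !mxE.
by rewrite (bigD1 p) //= subrr mulr0 add0r.
Qed.

(** The predicate [P] selects a principal block of [B], so an index can be deleted without forming a
    submatrix. *)
Lemma row_eigenvector_gershgorin (F : numFieldType) (I : finType)
    (P : pred I) (B : I -> I -> F) (z : F) (u : I -> F) :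
    (forall j, P j -> z * u j = \sum_(k | P k) u k * B k j) ->
    (exists2 k, P k & u k != 0) ->
  exists2 k, P k & `|z - B k k| <= \sum_(j | P j && (j != k)) `|B k j|.
Proof.
move=> uB [k0 Pk0 uk0].
case: (pickP [pred k | P k &&
  (`|z - B k k| <= \sum_(j | P j && (j != k)) `|B k j|)]) => [k /andP[]|none].
  by exists k.
have far k : P k -> \sum_(j | P j && (j != k)) `|B k j| < `|z - B k k|.
  (* The order on [F] is only partial: negating [<=] into [<] requires both sides to be real. *)
  move=> Pk; have sum_norm : \sum_(j | P j && (j != k)) `|B k j| \is Num.real.
    by apply: sum_real => j _; apply: normr_real.
  rewrite real_ltNge ?normr_real //.
  by have /= := none k; rewrite Pk /= => ->.
have col j : P j ->
    `|u j| * `|z - B j j| <= \sum_(k | P k && (k != j)) `|u k| * `|B k j|.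
  move=> Pj; have -> : `|u j| * `|z - B j j| =
      `|\sum_(k | P k && (k != j)) u k * B k j|.
    by rewrite -normrM mulrBr mulrC uB // (bigD1 j) //= addrAC subrr add0r.
  by apply: le_trans (ler_norm_sum _ _ _) _; under eq_bigr do rewrite normrM.
(* Strictness comes from [k0] alone, since the other weights [|u k|] may be zero. *)
have : \sum_(k | P k) `|u k| * \sum_(j | P j && (j != k)) `|B k j|
    < \sum_(k | P k) `|u k| * `|z - B k k|.
  rewrite (bigD1 k0) //= [ltRHS](bigD1 k0) //=; apply: ltr_leD.
    by rewrite ltr_pM2l ?normr_gt0 ?far.
  by apply: ler_sum => k /andP[Pk _]; rewrite ler_wpM2l // ltW ?far.
suff /le_lt_trans h : \sum_(k | P k) `|u k| * `|z - B k k| <=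
    \sum_(k | P k) `|u k| * \sum_(j | P j && (j != k)) `|B k j|.
  by move=> /h; rewrite ltxx.
apply: le_trans (ler_sum _ col) _.
under [leRHS]eq_bigr do rewrite mulr_sumr.
rewrite (exchange_big_dep P) /=; last by move=> j k _ /andP[].
apply: ler_sum => k Pk.
by under eq_bigl => j do rewrite Pk /= eq_sym.
Qed.

Theorem theorem2p2 (R : realType) (n : nat) (A : 'M[R[i]]_n) (gamma : R[i])
    (hA : constant_row_sum A gamma) :
  [set z : R[i] | eigenvalue A z]
    `<=` \bigcap_(p in [set: 'I_n]) (gershgorin_region A p `|` [set gamma]).
Proof.
move=> z /= /eigenvalueP[v vA vN0] p _.
have [->|zNgamma] := eqVneq z gamma; [by right | left].
have v0 := row_eigenvector_sum_eq0 hA vA zNgamma.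
have [||k kp hk] := @row_eigenvector_gershgorin _ _ (fun k => k != p)
    (fun k j => A k j - A p j) z (v 0).
- by move=> j _; apply: row_eigenvector_deflation.
(* If [v] vanished off [p], its zero sum would force [v 0 p = 0] too. *)
- apply/exists_inP; apply: contraNT vN0 => /exists_inPn vk0.
  have vk k : k != p -> v 0 k = 0 by move=> /vk0 /negPn /eqP.
  apply/eqP/rowP => k; rewrite mxE; have [->|/vk //] := eqVneq k p.
  by move: v0; rewrite (bigD1 p) //= big1 ?addr0.
exists k => //=.
by rewrite /gershgorin_disc /= -addrA [- _ + _]addrC -(opprB (A k k)).
Qed.
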